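(* Let $A \in \mathbb{R}^{m \times n_A}$ and $B \in \mathbb{R}^{m \times n_B}$ with nonzero columns, let $OPT_k$ be a set of $k$ columns of $B$ maximizing $f_A(S)$ subject to $|S| = k$, with $\sigma_{\min}(OPT_k) > 0$. Let $\varepsilon, \delta > 0$ with $\varepsilon + \delta \le 1$, and let $T_r$ be the set of columns output by $\textsc{Lazier-than-lazy Greedy}(A, B, r)$ for $r = \frac{16k}{\varepsilon\, \sigma_{\min}(OPT_k)}$. Then $$\mathbb{E}[f_A(T_r)] \ge (1 - \varepsilon - \delta)\, f_A(OPT_k).$$ Further, this algorithm evaluates marginal gains only $\frac{16 n_B \log(1/\delta)}{\varepsilon\, \sigma_{\min}(OPT_k)}$ times.
   Context: For a finite set $V$ of vectors in $\mathbb{R}^m$, $\Pi_V$ is the orthogonal projector onto $\mathrm{span}(V)$ and, for a matrix $M$ with $m$ rows, $f_M(V) = \|\Pi_V M\|_F^2$. For a finite set $V$ of nonzero vectors, $\sigma_{\min}(V)$ is the smallest squared singular value of the matrix whose columns are the vectors of $V$ rescaled to unit length. The marginal gain of a column $v$ with respect to a set $T$ is $f_A(T \cup \{v\}) - f_A(T)$. $\textsc{Lazier-than-lazy Greedy}(A, B, r)$: start with $T = \emptyset$; for $r$ iterations, draw a subset $R$ of size $\frac{n_B \log(1/\delta)}{k}$ uniformly at random from the columns of $B$ not in $T$, add to $T$ the column of $R$ with the largest marginal gain with respect to $T$; return $T$. *)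

(* Defs.v *)
From HB Require Import structures.
From mathcomp Require Import all_boot all_order all_algebra.
From mathcomp Require Import reals exp.
Set Implicit Arguments. Unset Strict Implicit. Unset Printing Implicit Defensive.
Import Order.TTheory GRing.Theory Num.Theory.
Local Open Scope ring_scope.

Section Defs.
Variable R : realType.

(* The columns of B indexed by S (other columns zeroed: same span). *)
Definition colS (m n : nat) (B : 'M[R]_(m, n)) (S : {set 'I_n}) : 'M[R]_(m, n) :=
  \matrix_(i, j) (if j \in S then B i j else 0).

(* Orthogonal projector onto the column span of X : Q^T (Q Q^T)^-1 Q, where the
   rows of Q form a basis of the row space of X^T (= column space of X). *)
Definition proj_mx (m n : nat) (X : 'M[R]_(m, n)) : 'M[R]_m :=
  let Q := row_base X^T in Q^T *m invmx (Q *m Q^T) *m Q.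

Definition frob2 (m n : nat) (M : 'M[R]_(m, n)) : R :=
  \sum_(i < m) \sum_(j < n) M i j ^+ 2.

Definition fA (m nA nB : nat) (A : 'M[R]_(m, nA)) (B : 'M[R]_(m, nB))
  (S : {set 'I_nB}) : R := frob2 (proj_mx (colS B S) *m A).

Definition gain (m nA nB : nat) (A : 'M[R]_(m, nA)) (B : 'M[R]_(m, nB))
  (T : {set 'I_nB}) (j : 'I_nB) : R := fA A B (j |: T) - fA A B T.

Definition normcols (m n : nat) (B : 'M[R]_(m, n)) (S : {set 'I_n}) : 'M[R]_(m, #|S|) :=
  \matrix_(i, j) (B i (enum_val j) / Num.sqrt (\sum_(i' < m) B i' (enum_val j) ^+ 2)).

(* smallest squared singular value = smallest eigenvalue of N^T N *)
Definition sigma_min (m n : nat) (B : 'M[R]_(m, n)) (S : {set 'I_n}) : R :=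
  let N := normcols B S in inf (fun a : R => eigenvalue (N^T *m N) a).

(* Lazier-than-lazy greedy.  [sel T Q] is the column of Q picked (tie-breaking
   rule arbitrary, see [is_greedy_sel]); samples Q are uniformly random subsets of
   the columns not in T of size s (or all remaining columns if fewer remain). *)
Definition is_greedy_sel (m nA nB : nat) (A : 'M[R]_(m, nA)) (B : 'M[R]_(m, nB))
  (sel : {set 'I_nB} -> {set 'I_nB} -> 'I_nB) : Prop :=
  forall T Q, Q != finset.set0 ->
    sel T Q \in Q /\ (forall j, j \in Q -> gain A B T j <= gain A B T (sel T Q)).

Definition validQ (n s : nat) (T Q : {set 'I_n}) : bool :=
  (Q \subset ~: T) && (#|Q| == minn s #|~: T|).

Definition ltl_step (n : nat) (sel : {set 'I_n} -> {set 'I_n} -> 'I_n)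
  (T Q : {set 'I_n}) : {set 'I_n} :=
  if Q == finset.set0 then T else sel T Q |: T.

Fixpoint ltl_exp (n : nat) (f : {set 'I_n} -> R)
  (sel : {set 'I_n} -> {set 'I_n} -> 'I_n) (s r : nat) (T : {set 'I_n}) : R :=
  match r with
  | 0 => f T
  | r'.+1 =>
      (\sum_(Q : {set 'I_n} | validQ s T Q) ltl_exp f sel s r' (ltl_step sel T Q))
        / #|[set Q : {set 'I_n} | validQ s T Q]|%:R
  end.

(* worst-case (over the random samples) number of marginal-gain evaluations
   in r iterations started from T: each iteration evaluates |Q| gains *)
Fixpoint ltl_evals (n : nat) (sel : {set 'I_n} -> {set 'I_n} -> 'I_n)
  (s r : nat) (T : {set 'I_n}) : nat :=
  match r with
  | 0 => 0%N
  | r'.+1 => \max_(Q : {set 'I_n} | validQ s T Q)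
               (#|Q| + ltl_evals sel s r' (ltl_step sel T Q))%N
  end.

End Defs.

(* Main.v *)
(** Write [F = f OPT], [f = f T], and let [N] be the matrix of normalized columns
of [OPT]. Adding [v] to [T] gains at least [|v^T (A - P_T A)|^2 / |v|^2], so the
gains over [OPT] add up to at least [|N^T (A - P_T A)|^2]; Cauchy-Schwarz against
the coordinates of [P_OPT A] in [N] turns this into
[sigma (F - f)^2 / (4 F)] whenever [f <= F].

A uniform sample meets [OPT \ T] with probability at least
[(1 - delta) |OPT \ T| / k], and, given that, the best sampled gain is at least
the average gain over the sampled part of [OPT \ T], whose expectation is by
symmetry the average gain over [OPT \ T]. Hence one step decreases [y = F - f] in
expectation by at least [c y^2] with [c = (1 - delta) sigma / (4 k F)], and
[y / (1 + c r y)] bounds the expected deficit after [r] steps. *)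

Require Import Defs.
From HB Require Import structures.
From mathcomp Require Import all_boot all_order all_algebra.
From mathcomp Require Import perm reals sequences exp ring lra.
Import Order.TTheory GRing.Theory Num.Theory.
Local Open Scope ring_scope.
Set Implicit Arguments. Unset Strict Implicit. Unset Printing Implicit Defensive.

(** * The Frobenius norm, its inner product and Cauchy-Schwarz *)

Section Frobenius.
Variable R : realType.

Lemma frob2_ge0 (m n : nat) (M : 'M[R]_(m, n)) : 0 <= frob2 M.
Proof. by apply: sumr_ge0 => i _; apply: sumr_ge0 => j _; apply: sqr_ge0. Qed.

Lemma frob2_tr (m n : nat) (M : 'M[R]_(m, n)) : frob2 M^T = frob2 M.
Proof.
rewrite /frob2 exchange_big /=.
by apply: eq_bigr => i _; apply: eq_bigr => j _; rewrite mxE.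
Qed.

Lemma frob2E (m n : nat) (M : 'M[R]_(m, n)) : frob2 M = \tr (M^T *m M).
Proof.
rewrite /frob2 /mxtrace exchange_big /=; apply: eq_bigr => j _.
by rewrite mxE; apply: eq_bigr => i _; rewrite mxE expr2.
Qed.

Lemma frob2_eq0 (m n : nat) (M : 'M[R]_(m, n)) : (frob2 M == 0) = (M == 0).
Proof.
apply/eqP/eqP => [M0|->]; last first.
  by rewrite /frob2 big1 // => i _; rewrite big1 // => j _; rewrite mxE expr0n.
apply/matrixP => i j; rewrite mxE; apply/eqP; rewrite -sqrf_eq0.
have ge0 i' : 0 <= \sum_j M i' j ^+ 2.
  by apply: sumr_ge0 => j' _; apply: sqr_ge0.
have rowi0 : \sum_j M i j ^+ 2 = 0 by apply: (psumr_eq0P _ M0).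
by apply/eqP; apply: (psumr_eq0P _ rowi0) => // j' _; apply: sqr_ge0.
Qed.

Lemma frob2_col (m n : nat) (M : 'M[R]_(m, n)) :
  frob2 M = \sum_j frob2 (col j M).
Proof.
rewrite /frob2 exchange_big /=; apply: eq_bigr => j _; apply: eq_bigr => i _.
by rewrite big_ord1 mxE.
Qed.

Lemma frob2_row (m n : nat) (M : 'M[R]_(m, n)) :
  frob2 M = \sum_i frob2 (row i M).
Proof.
rewrite /frob2; apply: eq_bigr => i _.
by rewrite big_ord1; apply: eq_bigr => j _; rewrite mxE.
Qed.

Lemma frob2BZ (m n : nat) (X Y : 'M[R]_(m, n)) (c : R) :
  frob2 (X - c *: Y) = frob2 X - 2 * c * \tr (X^T *m Y) + c ^+ 2 * frob2 Y.
Proof.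
have trC : \tr (Y^T *m X) = \tr (X^T *m Y).
  by rewrite -mxtrace_tr trmx_mul trmxK.
rewrite !frob2E [(X - _)^T]linearB /= [(c *: Y)^T]linearZ /= mulmxBl !mulmxBr.
rewrite -!scalemxAl -!scalemxAr scalerA !linearB !linearZ /= trC; ring.
Qed.

Lemma cauchy_schwarz_mx (m n : nat) (X Y : 'M[R]_(m, n)) :
  \tr (X^T *m Y) ^+ 2 <= frob2 X * frob2 Y.
Proof.
have [/eqP Y0|Yn0] := eqVneq (frob2 Y) 0.
  move: Y0; rewrite frob2_eq0 => /eqP ->.
  by rewrite mulmx0 mxtrace0 expr0n mulr_ge0 ?frob2_ge0.
have Ygt0 : 0 < frob2 Y by rewrite lt_def Yn0 frob2_ge0.
have := frob2_ge0 (X - (\tr (X^T *m Y) / frob2 Y) *: Y); rewrite frob2BZ.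
set t := \tr _ => le0; rewrite -subr_ge0.
have -> : frob2 X * frob2 Y - t ^+ 2 =
  frob2 Y * (frob2 X - 2 * (t / frob2 Y) * t + (t / frob2 Y) ^+ 2 * frob2 Y).
  by field.
by rewrite mulr_ge0 // ltW.
Qed.

(** Entry [(i, j)] of the product is the inner product of row [i] and column [j]; Cauchy-Schwarz
    applies to each. *)
Lemma frob2_mul_le (m n p : nat) (X : 'M[R]_(m, n)) (Y : 'M[R]_(n, p)) :
  frob2 (X *m Y) <= frob2 X * frob2 Y.
Proof.
rewrite (frob2_row X) (frob2_col Y) big_distrlr /=.
apply: ler_sum => i _; apply: ler_sum => j _.
have := cauchy_schwarz_mx (row i X)^T (col j Y).
rewrite trmxK frob2_tr; suff -> : \tr (row i X *m col j Y) = (X *m Y) i j by [].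
rewrite /mxtrace big_ord1 !mxE.
by apply: eq_bigr => l _; rewrite !mxE.
Qed.

End Frobenius.

(** * Orthogonal projectors onto column spans *)

Section Projector.
Variable R : realType.

(** If [K] annihilates [Q Q^T], then [|K Q|^2 = 0], so [K Q = 0], and freeness of the rows of [Q]
    gives [K = 0]. *)
Lemma gram_unitmx (p n : nat) (Q : 'M[R]_(p, n)) :
  row_free Q -> Q *m Q^T \in unitmx.
Proof.
move=> freeQ; rewrite -row_free_unit -kermx_eq0.
set K := kermx _; have KQ0 : K *m Q *m (K *m Q)^T = 0.
  by rewrite trmx_mul mulmxA -(mulmxA K) mulmx_ker mul0mx.
rewrite -(mulmx_free_eq0 _ freeQ) -trmx_eq0 -frob2_eq0 frob2E trmxK.
by rewrite KQ0 mxtrace0.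
Qed.

Variables (m n : nat) (X : 'M[R]_(m, n)).
Let P := Defs.proj_mx X.

Lemma proj_mx_sym : P^T = P.
Proof.
by rewrite /P /Defs.proj_mx !(trmx_mul, trmxK, trmx_inv) mulmxA.
Qed.

Lemma proj_mx_sub (p : nat) (Y : 'M[R]_(p, m)) : (Y *m P <= X^T)%MS.
Proof.
rewrite /P /Defs.proj_mx mulmxA.
by apply: submx_trans (submxMl _ _) _; rewrite eq_row_base.
Qed.

Lemma proj_mx_id (p : nat) (Y : 'M[R]_(p, m)) : (Y <= X^T)%MS -> Y *m P = Y.
Proof.
move=> sYX.
have /submxP[W ->] : (Y <= row_base X^T)%MS by rewrite eq_row_base.
rewrite /P /Defs.proj_mx; move: (row_base_free X^T) W.
move: (row_base X^T) => Q freeQ W.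
by rewrite !mulmxA -(mulmxA W) mulmxK // gram_unitmx.
Qed.

Lemma proj_mx_idem : P *m P = P.
Proof. by rewrite proj_mx_id // -[P]mul1mx proj_mx_sub. Qed.

End Projector.

Lemma proj_mx_absorb (R : realType) (m n n' : nat) (X : 'M[R]_(m, n))
    (X' : 'M[R]_(m, n')) :
  (X^T <= X'^T)%MS -> Defs.proj_mx X *m Defs.proj_mx X' = Defs.proj_mx X.
Proof.
move=> sXX'; apply: proj_mx_id; rewrite (submx_trans _ sXX') //.
by rewrite -[Defs.proj_mx X]mul1mx proj_mx_sub.
Qed.

(** No diagonalization: the largest [mu] with [mu |y|^2 <= |N y|^2] for all [y] is itself an
    eigenvalue, because invertibility of [G - mu I] would allow a larger [mu]. The infimum is
    therefore at most [mu]. *)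
Lemma smallest_eigenvalue_gram (R : realType) (m n : nat) (N : 'M[R]_(m, n))
    (z : 'cV[R]_n) : (0 < n)%N ->
  inf (fun a : R => eigenvalue (N^T *m N) a) * frob2 z <= frob2 (N *m z).
Proof.
move=> n_gt0; set G := N^T *m N.
have quad (t : R) (y : 'cV[R]_n) :
    frob2 (N *m y) - t * frob2 y = \tr (y^T *m ((G - t%:M) *m y)).
  rewrite mulmxBl mulmxBr linearB /= !frob2E trmx_mul -!mulmxA mul_scalar_mx.
  by rewrite -scalemxAr linearZ.
pose E := fun t : R => forall y : 'cV[R]_n, t * frob2 y <= frob2 (N *m y).
have E0 : E 0 by move=> y; rewrite mul0r frob2_ge0.
have ubE : classical_sets.has_ubound E.
  pose e : 'cV[R]_n := delta_mx (Ordinal n_gt0) ord0.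
  exists (frob2 (N *m e)) => t /(_ e); suff -> : frob2 e = 1 by rewrite mulr1.
  by rewrite frob2E trmx_delta mul_delta_mx /mxtrace big_ord1 mxE.
pose mu := sup E.
have Emu : E mu.
  move=> y; have [->|yn0] := eqVneq (frob2 y) 0; first by rewrite mulr0 frob2_ge0.
  have ygt0 : 0 < frob2 y by rewrite lt_def yn0 frob2_ge0.
  rewrite -ler_pdivlMr //; apply: ge_sup; first by exists 0.
  by move=> t Et; rewrite ler_pdivlMr.
have eig_ge0 (a : R) : eigenvalue G a -> 0 <= a.
  case/eigenvalueP => v vG vn0.
  have vgt0 : 0 < frob2 v by rewrite lt_def frob2_eq0 vn0 frob2_ge0.
  rewrite -(pmulr_lge0 _ vgt0) -(frob2_tr v) frob2E trmxK -mxtraceZ scalemxAl -vG.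
  have -> : v *m G *m v^T = (N *m v^T)^T *m (N *m v^T).
    by rewrite trmx_mul trmxK !mulmxA.
  by rewrite -frob2E frob2_ge0.
suff eig_mu : eigenvalue G mu.
  apply: le_trans (Emu z); apply: ler_wpM2r; first exact: frob2_ge0.
  by apply: ge_inf => //; exists 0 => a; apply: eig_ge0.
rewrite /eigenvalue /eigenspace kermx_eq0 row_free_unit.
apply/negP => unitM; set M := G - mu%:M in unitM.
have symM : M^T = M by rewrite linearB /= tr_scalar_mx trmx_mul trmxK.
have symK : (invmx M)^T = invmx M by rewrite trmx_inv symM.
have qge0 (y : 'cV_n) : 0 <= \tr (y^T *m (M *m y)) by rewrite -quad subr_ge0.
(* This constant gives [y^T M^-1 y <= C |y|^2], from [2 <y, M^-1 y> <= |y|^2 + |M^-1 y|^2]. *)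
pose C := (1 + frob2 (invmx M)) / 2.
have C_gt0 : 0 < C.
  by rewrite divr_gt0 // (lt_le_trans ltr01) // lerDl frob2_ge0.
(* A nonnegative form with invertible matrix is coercive, by Cauchy-Schwarz for
   that form applied to [y] and [invmx M *m y]. *)
have Emu' : E (mu + C^-1).
  move=> y; rewrite mulrDl -lerBrDl quad -/M.
  have tr_le : \tr (y^T *m (invmx M *m y)) <= C * frob2 y.
    have := frob2_ge0 (y - 1 *: (invmx M *m y)); rewrite frob2BZ.
    have := frob2_mul_le (invmx M) y; rewrite /C; lra.
  have := qge0 (y - C^-1 *: (invmx M *m y)).
  rewrite mulmxBr -scalemxAr mulKVmx // [(_ - _)^T]linearB /=.
  rewrite [(_ *: _)^T]linearZ /= trmx_mul symK mulmxBl !mulmxBr -!scalemxAl.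
  rewrite -!scalemxAr -!mulmxA mulKmx // !linearB !linearZ /=.
  rewrite -frob2E.
  have := ler_wpM2l (sqr_ge0 C^-1) tr_le.
  have -> : C^-1 ^+ 2 * (C * frob2 y) = C^-1 * frob2 y by field; rewrite gt_eqF.
  rewrite expr2; lra.
have := ub_le_sup ubE Emu'; rewrite -/mu.
by rewrite gerDl leNgt invr_gt0 C_gt0.
Qed.

(** * Marginal gains against the residual of [A] *)

Section Gains.
Variables (R : realType) (m nA nB : nat) (A : 'M[R]_(m, nA)) (B : 'M[R]_(m, nB)).
Let P (T : {set 'I_nB}) := Defs.proj_mx (colS B T).

Lemma row_colS (S : {set 'I_nB}) (j : 'I_nB) :
  row j (colS B S)^T = if j \in S then (col j B)^T else 0.
Proof. by apply/rowP => i; case: ifP => jS; rewrite !mxE jS. Qed.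

Lemma colS_submx (S T : {set 'I_nB}) :
  S \subset T -> ((colS B S)^T <= (colS B T)^T)%MS.
Proof.
move=> /subsetP sST; apply/row_subP => j; rewrite row_colS.
case: ifPn => [/sST jT|_]; last exact: sub0mx.
by have := row_sub j (colS B T)^T; rewrite row_colS jT.
Qed.

Lemma fAE (T : {set 'I_nB}) : fA A B T = \tr (A^T *m (P T *m A)).
Proof.
rewrite /fA frob2E trmx_mul proj_mx_sym -mulmxA (mulmxA (Defs.proj_mx _)).
by rewrite proj_mx_idem.
Qed.

Lemma fA_set0 : fA A B finset.set0 = 0.
Proof.
suff P0 : P finset.set0 = 0 by rewrite fAE P0 mul0mx mulmx0 mxtrace0.
have colS0 : colS B finset.set0 = 0 by apply/matrixP => i j; rewrite !mxE inE.
have := proj_mx_sub (colS B finset.set0) 1%:M.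
by rewrite mul1mx -/(P _) [X in (_ <= X^T)%MS]colS0 trmx0 eqmx0 submx0 => /eqP.
Qed.

(** The spans are nested, so the difference of the two projectors is again symmetric and
    idempotent. *)
Lemma gainE (T : {set 'I_nB}) (j : 'I_nB) :
  gain A B T j = frob2 ((P (j |: T) - P T) *m A).
Proof.
have PP' : P T *m P (j |: T) = P T by apply/proj_mx_absorb/colS_submx/subsetUr.
have P'P : P (j |: T) *m P T = P T.
  by rewrite -[LHS]trmxK trmx_mul !proj_mx_sym PP' proj_mx_sym.
set D := P (j |: T) - P T.
have symD : D^T = D by rewrite /D linearB /= !proj_mx_sym.
have idemD : D *m D = D.
  by rewrite {1}/D mulmxBl !mulmxBr !proj_mx_idem PP' P'P subrr subr0.
rewrite /gain !fAE -linearB /= -mulmxBr -mulmxBl -/D.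
by rewrite frob2E trmx_mul symD -mulmxA (mulmxA D) idemD.
Qed.

Lemma gain_ge0 (T : {set 'I_nB}) (j : 'I_nB) : 0 <= gain A B T j.
Proof. by rewrite gainE frob2_ge0. Qed.

(** The column [b] lies in the enlarged span, hence [b^T (I - P T) = b^T (P (j |: T) - P T)]. *)
Lemma frob2_residual_le_gain (T : {set 'I_nB}) (j : 'I_nB) :
  frob2 ((col j B)^T *m (A - P T *m A)) <= frob2 (col j B) * gain A B T j.
Proof.
rewrite gainE -(frob2_tr (col j B)).
suff -> : (col j B)^T *m (A - P T *m A) =
    (col j B)^T *m ((P (j |: T) - P T) *m A) by apply: frob2_mul_le.
have bP' : (col j B)^T *m P (j |: T) = (col j B)^T.
  apply: proj_mx_id; have := row_sub j (colS B (j |: T))^T.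
  by rewrite row_colS setU11.
move: (P (j |: T)) (P T) bP' => P' P0 bP'.
by rewrite mulmxBl !mulmxBr !mulmxA bP'.
Qed.

Hypothesis colB_neq0 : forall j, col j B != 0.

Lemma normcols_colE (S : {set 'I_nB}) (i : 'I_#|S|) :
  col i (normcols B S) =
  (Num.sqrt (frob2 (col (enum_val i) B)))^-1 *: col (enum_val i) B.
Proof.
apply/colP => l; rewrite !mxE mulrC; congr ((Num.sqrt _)^-1 * _).
by apply: eq_bigr => l' _; rewrite big_ord1 mxE.
Qed.

Lemma normcols_residual_le (T S : {set 'I_nB}) :
  frob2 ((normcols B S)^T *m (A - P T *m A)) <= \sum_(j in S) gain A B T j.
Proof.
rewrite big_enum_val frob2_row; apply: ler_sum => i _.
set b := col (enum_val i) B.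
have b_gt0 : 0 < frob2 b by rewrite lt_def frob2_eq0 colB_neq0 frob2_ge0.
rewrite row_mul -tr_col normcols_colE -/b.
rewrite [(_ *: b)^T]linearZ /= -scalemxAl.
have frob2Z (c : R) (p q : nat) (M : 'M[R]_(p, q)) :
    frob2 (c *: M) = c ^+ 2 * frob2 M.
  by rewrite !frob2E [(c *: M)^T]linearZ /= -scalemxAl -scalemxAr scalerA linearZ.
rewrite frob2Z exprVn sqr_sqrtr ?frob2_ge0 // mulrC ler_pdivrMr // mulrC.
exact: frob2_residual_le_gain.
Qed.

(** Rescaling nonzero columns does not change their span. *)
Lemma proj_normcols (S : {set 'I_nB}) :
  exists Z, P S *m A = normcols B S *m Z.
Proof.
have sBN : ((colS B S)^T <= (normcols B S)^T)%MS.
  apply/row_subP => j; rewrite row_colS; case: ifPn => [jS|_]; last exact: sub0mx.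
  have b_gt0 : 0 < frob2 (col j B) by rewrite lt_def frob2_eq0 colB_neq0 frob2_ge0.
  have := row_sub (enum_rank_in jS j) (normcols B S)^T.
  rewrite -tr_col normcols_colE enum_rankK_in // [(_ *: _)^T]linearZ /=.
  rewrite eqmx_scale //.
  by rewrite invr_eq0 sqrtr_eq0 -ltNge.
have /submxP[Z PZ] : (A^T *m P S <= (normcols B S)^T)%MS.
  exact: submx_trans (proj_mx_sub _ _) sBN.
by exists Z^T; apply: trmx_inj; rewrite trmx_mul proj_mx_sym PZ trmx_mul trmxK.
Qed.

(** For empty [S] the Gram matrix is 0 by 0 and has no eigenvalue, and [inf] of the empty set is 0
    by convention. *)
Lemma sigma_min_gt0_card (S : {set 'I_nB}) : 0 < sigma_min B S -> (0 < #|S|)%N.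
Proof.
rewrite /sigma_min lt0n; case: eqP => // S0.
rewrite (_ : (fun a => _) = classical_sets.set0) ?inf0 ?ltxx //.
apply: boolp.funext => a; apply: boolp.propext; split=> //.
case/eigenvalueP => v _ /eqP[]; apply/rowP => i.
by have := ltn_ord i; rewrite [X in (_ < X)%N]S0.
Qed.

(* With [P S *m A = normcols B S *m Z], the inner product of [Z] with
   [(normcols B S)^T *m (A - P T *m A)] is at least half of [f S - f T], while
   [Z] is controlled by the smallest singular value. *)
Lemma sum_gain_ge (T S : {set 'I_nB}) :
  0 < sigma_min B S -> fA A B T <= fA A B S ->
  sigma_min B S * (fA A B S - fA A B T) ^+ 2 <=
  4 * fA A B S * \sum_(j in S) gain A B T j.
Proof.
move=> sigma_gt0 leTS; have [Z PZ] := proj_normcols S.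
have S_gt0 := sigma_min_gt0_card sigma_gt0.
have Z_le : sigma_min B S * frob2 Z <= fA A B S.
  rewrite /fA -/(P S) PZ !(frob2_col Z) frob2_col mulr_sumr; apply: ler_sum => j _.
  rewrite [col j (_ *m Z)]colE -mulmxA -colE; exact: smallest_eigenvalue_gram.
set W := (normcols B S)^T *m (A - P T *m A).
(* The factor 1/2 comes from [0 <= |P S A - P T A|^2], which bounds the inner product of the two
   projections by [(f S + f T) / 2]. *)
have tr_ge : (fA A B S - fA A B T) / 2 <= \tr (Z^T *m W).
  rewrite /W mulmxA -trmx_mul -PZ mulmxBr linearB /=.
  have -> : \tr ((P S *m A)^T *m A) = fA A B S.
    by rewrite fAE trmx_mul proj_mx_sym mulmxA.
  have := frob2_ge0 (P S *m A - 1 *: (P T *m A)); rewrite frob2BZ -!/(fA A B _).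
  lra.
have CS := cauchy_schwarz_mx Z W.
have W_le : frob2 W <= \sum_(j in S) gain A B T j := normcols_residual_le T S.
have sq_le : (fA A B S - fA A B T) ^+ 2 <= 4 * (frob2 Z * frob2 W).
  have : ((fA A B S - fA A B T) / 2) ^+ 2 <= \tr (Z^T *m W) ^+ 2.
    by rewrite ler_sqr ?nnegrE // ?(le_trans _ tr_ge) //; lra.
  rewrite expr_div_n; lra.
apply: le_trans (ler_wpM2l (ltW sigma_gt0) sq_le) _.
have := ler_pM (mulr_ge0 (ltW sigma_gt0) (frob2_ge0 Z)) (frob2_ge0 W) Z_le W_le.
rewrite -!mulrA; lra.
Qed.

End Gains.

(** * Counting the samples that miss a given set *)

Section Sampling.
Variable n : nat.
Implicit Types S T O Q : {set 'I_n}.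

Lemma card_validQ (s : nat) T :
  #|[set Q | validQ s T Q]| = 'C(#|~: T|, minn s #|~: T|).
Proof. exact: cards_draws. Qed.

Lemma card_validQ_gt0 (s : nat) T : (0 < #|[set Q | validQ s T Q]|)%N.
Proof. by rewrite card_validQ bin_gt0 geq_minr. Qed.

Lemma card_validQ_miss (s : nat) T O : O \subset ~: T ->
  #|[set Q | validQ s T Q & Q :&: O == finset.set0]| =
  'C(#|~: T| - #|O|, minn s #|~: T|).
Proof.
move=> sOT; rewrite -[in (_ - #|O|)%N](setIidPr sOT) -cardsD -cards_draws.
apply: eq_card => Q; rewrite !inE /validQ subsetD setI_eq0.
by rewrite -!andbA; congr (_ && _); rewrite andbC.
Qed.

(** Factor by factor, [(u - p - i) / (u - i) <= (u - p) / u], with denominators cleared. *)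
Lemma ffact_sub_le (u p q : nat) :
  ((u - p) ^_ q * u ^ q <= u ^_ q * (u - p) ^ q)%N.
Proof.
elim: q => [|q IH]; first by rewrite !ffactn0.
rewrite !ffactnSr !expnSr.
have step : ((u - p - q) * u <= (u - q) * (u - p))%N.
  rewrite !mulnBl [(u * (u - p))%N]mulnBr [(p * u)%N]mulnC -!subnDA.
  by rewrite leq_sub2l // leq_add2l mulnBr; apply: leq_subr.
rewrite mulnACA [in leqRHS]mulnACA; exact: leq_mul.
Qed.

End Sampling.

(** * Averages over uniform samples *)

Section SamplingAverage.
Variables (R : realType) (n : nat).
Implicit Types S T O Q : {set 'I_n}.

(** The ratio of binomials is at most [(1 - p/u)^q], and [1 - x <= exp (- x)]. *)
Lemma bin_sub_le_expR (u p q : nat) : (0 < u)%N -> (p <= u)%N ->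
  'C(u - p, q)%:R <= expR (- (q%:R * p%:R / u%:R)) * 'C(u, q)%:R :> R.
Proof.
move=> u_gt0 le_pu; have uR_gt0 : 0 < u%:R :> R by rewrite ltr0n.
have le_nat : ('C(u - p, q) * u ^ q <= 'C(u, q) * (u - p) ^ q)%N.
  rewrite -(leq_pmul2r (fact_gt0 q)) mulnAC bin_ffact.
  by rewrite [leqRHS]mulnAC bin_ffact ffact_sub_le.
rewrite -(ler_pM2r (exprn_gt0 q uR_gt0)) .
apply: (@le_trans _ _ ('C(u, q)%:R * (u - p)%:R ^+ q)).
  by rewrite -!natrX -!natrM ler_nat.
rewrite mulrAC mulrC ler_wpM2r //.
have -> : - (q%:R * p%:R / u%:R) = q%:R * (- (p%:R / u%:R)) :> R by ring.
rewrite expRM_natl -exprMn lerXn2r ?nnegrE ?mulr_ge0 ?expR_ge0 //.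
have -> : (u - p)%:R = (1 - p%:R / u%:R) * u%:R :> R.
  by rewrite natrB //; field; rewrite gt_eqF.
by rewrite ler_wpM2r // expR_ge1Dx.
Qed.

Lemma card_validQ_miss_le (s : nat) T O :
    O \subset ~: T -> O != finset.set0 ->
  #|[set Q | validQ s T Q & Q :&: O == finset.set0]|%:R
  <= expR (- (s%:R * #|O|%:R / n%:R)) * #|[set Q | validQ s T Q]|%:R :> R.
Proof.
move=> sOT On0; rewrite card_validQ card_validQ_miss //.
have p_gt0 : (0 < #|O|)%N by rewrite card_gt0.
have p_le := subset_leq_card sOT.
have u_le : (#|~: T| <= n)%N by rewrite -[X in (_ <= X)%N]card_ord max_card.
(* A sample size above [#|~: T|] makes the sample all of [~: T], which cannot miss [O]: the count is
   0. *)
have [_|_] := leqP s #|~: T|; last first.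
  rewrite bin_small ?mulr_ge0 ?expR_ge0 // ltn_subrL p_gt0.
  exact: leq_trans p_le.
have u_gt0 := leq_trans p_gt0 p_le.
apply: le_trans (bin_sub_le_expR _ u_gt0 p_le) _.
rewrite ler_wpM2r // ler_expR lerN2 ler_wpM2l ?mulr_ge0 //.
by rewrite lef_pV2 ?posrE ?ltr0n ?(leq_trans u_gt0) // ler_nat.
Qed.

(** The transposition of [v] and [w] fixes [O] and [~: T], so it permutes the samples and exchanges
    the two index sets. *)
Lemma hit_weight_sym (s : nat) T O (v w : 'I_n) : O \subset ~: T ->
    v \in O -> w \in O ->
  \sum_(Q | validQ s T Q && (v \in Q)) (#|Q :&: O|%:R)^-1 =
  \sum_(Q | validQ s T Q && (w \in Q)) (#|Q :&: O|%:R)^-1 :> R.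
Proof.
move=> /subsetP sOT vO wO.
pose h Q := [set tperm v w x | x in Q].
have hK : involutive h.
  by move=> Q; rewrite /h -imset_comp (eq_imset _ (tpermK v w)) imset_id.
have stable (X : {set 'I_n}) : (v \in X) = (w \in X) -> h X = X.
  move=> vwX; apply/setP => x; rewrite -{1}(tpermK v w x).
  rewrite mem_imset; last exact: perm_inj.
  by case: tpermP => // ->; rewrite ?vwX.
have hO : h O = O by apply: stable; rewrite vO wO.
have hT : h (~: T) = ~: T by apply: stable; rewrite !sOT.
have hsub Q : (h Q \subset ~: T) = (Q \subset ~: T).
  by apply/idP/idP => /(imsetS (tperm v w)); rewrite -!/(h _) ?hK hT.
rewrite (reindex_inj (inv_inj hK)) /=; apply: eq_big => Q.
  rewrite /validQ hsub card_imset; last exact: perm_inj.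
  by rewrite -{1}(tpermR v w) mem_imset //; apply: perm_inj.
move=> _; rewrite -{1}hO /h -imsetI ?card_imset //; first exact: perm_inj.
by move=> x y _ _; apply: perm_inj.
Qed.

Lemma sum_validQ_const (s : nat) T (c : R) :
  \sum_(Q | validQ s T Q) c = c * #|[set Q | validQ s T Q]|%:R.
Proof.
by rewrite mulr_natr -sumr_const; apply: eq_bigl => Q; rewrite inE.
Qed.

(** Convexity of exp on the chord, obtained from [1 + z <= exp z] by comparing both endpoints with
    the tangent at [x] and mixing with weights [1 - x] and [x]. *)
Lemma expR_chord_le (L x : R) : 0 <= x <= 1 ->
  expR (- (L * x)) <= 1 - x + x * expR (- L).
Proof.
move=> /andP[x_ge0 x_le1]; set E := expR (- (L * x)).
have E_ge0 : 0 <= E := expR_ge0 _.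
have leL : E * (1 - L * (1 - x)) <= expR (- L).
  have -> : expR (- L) = E * expR (- (L * (1 - x))).
    by rewrite -expRD; congr expR; ring.
  rewrite ler_wpM2l //; exact: expR_ge1Dx.
have le1 : E * (1 + L * x) <= 1.
  have EK : E * expR (L * x) = 1 by rewrite -expRD addNr expR0.
  rewrite -[leRHS]EK ler_wpM2l //; exact: expR_ge1Dx.
have := ler_wpM2l x_ge0 leL.
have := ler_wpM2l (_ : 0 <= 1 - x) le1; rewrite subr_ge0 => /(_ x_le1).
have -> : E = (1 - x) * (E * (1 + L * x)) + x * (E * (1 - L * (1 - x))) by ring.
lra.
Qed.

(** After exchanging the sums, the coefficient of each [g w] is the same by symmetry, so that of [v]
    stands for all. *)
Lemma sum_average_sample (s : nat) T O (v : 'I_n) (g : 'I_n -> R) :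
    O \subset ~: T -> v \in O ->
  \sum_(Q | validQ s T Q) (\sum_(w in Q :&: O) g w) / #|Q :&: O|%:R =
  (\sum_(w in O) g w) *
  \sum_(Q | validQ s T Q && (v \in Q)) (#|Q :&: O|%:R)^-1.
Proof.
move=> sOT vO; under eq_bigr do rewrite mulr_suml.
rewrite (exchange_big_dep (mem O)) /=; last first.
  by move=> Q w _; rewrite inE => /andP[].
rewrite mulr_suml; apply: eq_bigr => w wO.
rewrite -mulr_sumr (hit_weight_sym s sOT vO wO); congr (_ * _).
by apply: eq_bigl => Q; rewrite inE wO andbT.
Qed.

(** The common coefficient [c] is found from the number of samples hitting [O]; with [x = #|O| / k],
    the fraction missing [O] is at most [delta^x <= 1 - x (1 - delta)]. *)
Lemma sum_average_sample_ge (s k : nat) T O (delta : R) (g : 'I_n -> R) :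
    O \subset ~: T -> (#|O| <= k)%N -> 0 < delta ->
    s%:R = n%:R * ln delta^-1 / k%:R -> (forall w, 0 <= g w) ->
  (1 - delta) / k%:R * (\sum_(w in O) g w) * #|[set Q | validQ s T Q]|%:R <=
  \sum_(Q | validQ s T Q) (\sum_(w in Q :&: O) g w) / #|Q :&: O|%:R.
Proof.
move=> sOT le_pk delta_gt0 sE g_ge0.
have [O0|On0] := eqVneq O finset.set0.
  rewrite O0 big_set0 mulr0 mul0r sumr_ge0 // => Q _.
  by rewrite divr_ge0 // sumr_ge0.
have /set0Pn[v vO] := On0.
have p_gt0 : (0 < #|O|)%N by rewrite card_gt0.
have n_gt0 : (0 < n)%N by case: {+}v => i; apply: leq_ltn_trans.
have kR_gt0 : 0 < k%:R :> R by rewrite ltr0n (leq_trans p_gt0).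
rewrite (sum_average_sample _ _ sOT vO) mulrAC mulrC ler_wpM2l ?sumr_ge0 //.
set c := \sum_(Q | _) _; set N := #|_|%:R.
have missE : #|[set Q | validQ s T Q & Q :&: O == finset.set0]|%:R =
    \sum_(Q | validQ s T Q) (if Q :&: O == finset.set0 then 1 else 0) :> R.
  by rewrite -sum1_card natr_sum -big_mkcondr; apply: eq_bigl => Q; rewrite inE.
(* For constant [g = 1] the sample average is 1 on a hit and 0 on a miss, since [0 / 0 = 0]. *)
have hitE : #|O|%:R * c =
    N - #|[set Q | validQ s T Q & Q :&: O == finset.set0]|%:R.
  rewrite missE /N -[X in _ = X - _]mul1r -sum_validQ_const -sumrB.
  have := sum_average_sample s (fun=> 1) sOT vO; rewrite sumr_const => <-.
  apply: eq_bigr => Q _; rewrite sumr_const.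
  have [->|QO] := eqVneq; first by rewrite cards0 mul0r subrr.
  by rewrite divff ?subr0 // pnatr_eq0 cards_eq0.
have miss_le : #|[set Q | validQ s T Q & Q :&: O == finset.set0]|%:R <=
    (1 - #|O|%:R / k%:R * (1 - delta)) * N.
  apply: le_trans (card_validQ_miss_le s sOT On0) _; rewrite ler_wpM2r //.
  have -> : s%:R * #|O|%:R / n%:R = ln delta^-1 * (#|O|%:R / k%:R).
    by rewrite sE; field; rewrite gt_eqF // gt_eqF // ltr0n.
  have x01 : 0 <= (#|O|%:R / k%:R : R) <= 1.
    by rewrite divr_ge0 //= ler_pdivrMr // mul1r ler_nat.
  apply: le_trans (expR_chord_le _ x01) _;
  by rewrite lnV ?posrE // opprK lnK ?posrE //; lra.
rewrite -(ler_pM2l (_ : 0 < #|O|%:R)) ?ltr0n // hitE; lra.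
Qed.

End SamplingAverage.

(** * Solving the quadratic recursion for the expected deficit *)

Section Recursion.
Variable R : realType.

(** The right-hand side is the tangent at [t] of the concave [y / (1 + c y)], which itself dominates
    [y - c y^2]. *)
Lemma quadratic_decrease (c y t : R) : 0 <= c -> 0 <= t -> 0 <= y ->
  y - c * y ^+ 2 <= (y + c * t ^+ 2) / (1 + c * t) ^+ 2.
Proof.
move=> c_ge0 t_ge0 y_ge0.
have ct_ge0 := mulr_ge0 c_ge0 t_ge0; have cy_ge0 := mulr_ge0 c_ge0 y_ge0.
rewrite ler_pdivlMr; last by apply: exprn_gt0; lra.
rewrite -(ler_pM2r (_ : 0 < 1 + c * y)); last lra.
rewrite -subr_ge0.
have -> : (y + c * t ^+ 2) * (1 + c * y) -
    (y - c * y ^+ 2) * (1 + c * t) ^+ 2 * (1 + c * y) =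
  c * (y - t) ^+ 2 + c * y * (c * y) * y * (1 + c * t) ^+ 2 by ring.
by rewrite addr_ge0 ?(mulr_ge0 _ (sqr_ge0 _)) ?(mulr_ge0 (mulr_ge0 _ _)).
Qed.

Variables (n s : nat) (sel : {set 'I_n} -> {set 'I_n} -> 'I_n).
Variables (f : {set 'I_n} -> R) (F c : R).
Hypothesis c_ge0 : 0 <= c.

Let avg (T : {set 'I_n}) (g : {set 'I_n} -> R) :=
  (\sum_(Q | validQ s T Q) g Q) / #|[set Q : {set 'I_n} | validQ s T Q]|%:R.

Hypothesis avg_ge : forall T, f T <= avg T (fun Q => f (ltl_step sel T Q)).
Hypothesis avg_ge_sq : forall T, f T <= F ->
  f T + c * (F - f T) ^+ 2 <= avg T (fun Q => f (ltl_step sel T Q)).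

(* The bound is the tangent line at [t] of the concave function
   [y |-> y / (1 + c * r * y)]: being affine in [F - f T], it commutes with the
   expectation over the samples. *)
Lemma ltl_exp_ge (r : nat) (T : {set 'I_n}) (t : R) : 0 <= t ->
  F - ltl_exp f sel s r T <=
  (F - f T + c * r%:R * t ^+ 2) / (1 + c * r%:R * t) ^+ 2.
Proof.
elim: r T t => [|r IH] T t t_ge0.
  by rewrite mulr0 !mul0r !addr0 expr1n divr1.
have ct_gt0 : 0 < 1 + c * t by rewrite ltr_wpDr // mulr_ge0.
have den_gt0 (i : nat) (x : R) : 0 <= x -> 0 < 1 + c * i%:R * x.
  by move=> x_ge0; rewrite ltr_wpDr ?mulr_ge0 // mulr_ge0.
have crt_gt0 := den_gt0 r.+1 t t_ge0.
set N : R := #|[set Q : {set 'I_n} | validQ s T Q]|%:R.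
have N_gt0 : 0 < N by rewrite ltr0n card_validQ_gt0.
(* The image of [t] under one step [y / (1 + c y)]: tangents taken at [t] and [t'] compose to the
   tangent at [t] of the composed map. *)
set t' := t / (1 + c * t).
have t'_ge0 : 0 <= t' by rewrite divr_ge0 // ltW.
set a := c * r%:R * t' ^+ 2; set b := (1 + c * r%:R * t') ^+ 2.
have b_gt0 : 0 < b by rewrite exprn_gt0 ?den_gt0.
have y'_le : F - avg T (fun Q => f (ltl_step sel T Q)) <=
    (F - f T + c * t ^+ 2) / (1 + c * t) ^+ 2.
  (* Once [f T] exceeds [F] the deficit is nonpositive; monotonicity then suffices, as dividing by
     [(1 + c t)^2 >= 1] only raises it. *)
  have [le_fF|/ltW le_Ff] := leP (f T) F.
    apply: le_trans (quadratic_decrease c_ge0 t_ge0 (_ : 0 <= F - f T)).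
      by have := avg_ge_sq le_fF; lra.
    by rewrite subr_ge0.
  apply: le_trans (_ : F - f T <= _); first by rewrite lerD2l lerN2 avg_ge.
  rewrite ler_pdivlMr ?exprn_gt0 //.
  have ct_ge0 : 0 <= c * t by rewrite mulr_ge0.
  have ct2_ge0 : 0 <= c * t ^+ 2 by rewrite mulr_ge0 // sqr_ge0.
  have y_le0 : F - f T <= 0 by rewrite subr_le0.
  have := mulr_le0_ge0 y_le0 ct_ge0.
  have := mulr_le0_ge0 y_le0 (sqr_ge0 (c * t)).
  lra.
have step : F - ltl_exp f sel s r.+1 T <=
    (F - avg T (fun Q => f (ltl_step sel T Q)) + a) / b.
  rewrite -(ler_pM2r N_gt0) [leLHS]mulrBl /= divfK ?gt_eqF //.
  rewrite -sum_validQ_const -sumrB.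
  apply: le_trans (ler_sum _ (fun Q _ => IH (ltl_step sel T Q) t' t'_ge0)) _.
  rewrite -/a -/b -mulr_suml mulrAC ler_pM2r ?invr_gt0 //.
  rewrite big_split sumrB !sum_validQ_const -/N /avg -/N.
  by rewrite mulrDl mulrBl divfK ?gt_eqF.
apply: le_trans step _.
apply: (@le_trans _ _ (((F - f T + c * t ^+ 2) / (1 + c * t) ^+ 2 + a) / b)).
  by rewrite ler_pM2r ?invr_gt0 // lerD2r.
suff -> : ((F - f T + c * t ^+ 2) / (1 + c * t) ^+ 2 + a) / b =
  (F - f T + c * r.+1%:R * t ^+ 2) / (1 + c * r.+1%:R * t) ^+ 2 by [].
rewrite /a /b /t' -natr1; field.
by rewrite !gt_eqF //; move: crt_gt0; rewrite -natr1; lra.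
Qed.

End Recursion.

(** * Expected progress of one greedy step *)

Section Greedy.
Variables (R : realType) (m nA nB : nat) (A : 'M[R]_(m, nA)) (B : 'M[R]_(m, nB)).
Variable sel : {set 'I_nB} -> {set 'I_nB} -> 'I_nB.
Hypothesis sel_greedy : is_greedy_sel A B sel.
Implicit Types S T O Q : {set 'I_nB}.

(** The selected gain is a maximum over [Q], hence at least any average over part of [Q]; an empty
    average is 0 and gains are nonnegative. *)
Lemma average_gain_le_step T O Q :
  fA A B T + (\sum_(w in Q :&: O) gain A B T w) / #|Q :&: O|%:R <=
  fA A B (ltl_step sel T Q).
Proof.
rewrite /ltl_step; case: eqVneq => [->|Qn0].
  by rewrite set0I big_set0 mul0r addr0.
have [selQ sel_max] := sel_greedy T Qn0.
rewrite -lerBrDl -/(gain A B T _).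
have [->|QOn0] := eqVneq (Q :&: O) finset.set0.
  by rewrite big_set0 mul0r gain_ge0.
rewrite ler_pdivrMr ?ltr0n ?card_gt0 // mulr_natr -sumr_const.
by apply: ler_sum => w; rewrite inE => /andP[wQ _]; apply: sel_max.
Qed.

(** Columns already in [T] have zero gain. *)
Lemma sum_gain_setD T S :
  \sum_(w in S :\: T) gain A B T w = \sum_(w in S) gain A B T w.
Proof.
rewrite [RHS](big_setID T) /= [X in X + _]big1 ?add0r // => w.
by rewrite inE => /andP[_ wT]; rewrite /gain (setUidPr _) ?sub1set // subrr.
Qed.

Lemma expected_step_ge (s k : nat) (delta : R) T S :
    (#|S| <= k)%N -> 0 < delta -> s%:R = nB%:R * ln delta^-1 / k%:R ->
  fA A B T + (1 - delta) / k%:R * \sum_(w in S) gain A B T w <=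
  (\sum_(Q | validQ s T Q) fA A B (ltl_step sel T Q)) /
    #|[set Q : {set 'I_nB} | validQ s T Q]|%:R.
Proof.
move=> le_Sk delta_gt0 sE.
rewrite ler_pdivlMr ?ltr0n ?card_validQ_gt0 // mulrDl -sum_validQ_const.
rewrite -sum_gain_setD.
apply: (@le_trans _ _ (\sum_(Q | validQ s T Q) (fA A B T +
    (\sum_(w in Q :&: (S :\: T)) gain A B T w) / #|Q :&: (S :\: T)|%:R))).
  rewrite [leRHS]big_split lerD2l; apply: sum_average_sample_ge => //.
  - by rewrite setDE subsetIr.
  - exact: leq_trans (subset_leq_card (subsetDl _ _)) le_Sk.
  - by move=> w; apply: gain_ge0.
by apply: ler_sum => Q _; apply: average_gain_le_step.
Qed.

End Greedy.

(** * Evaluation count and approximation guarantee *)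

Lemma ltl_evals_le (n s r : nat) (sel : {set 'I_n} -> {set 'I_n} -> 'I_n)
  (T : {set 'I_n}) : (ltl_evals sel s r T <= r * s)%N.
Proof.
elim: r T => [|r IH] T //=; apply/bigmax_leqP => Q /andP[_ /eqP ->].
by rewrite mulSn leq_add // geq_minl.
Qed.

Theorem theorem5 (R : realType) (m nA nB k : nat)
  (A : 'M[R]_(m, nA)) (B : 'M[R]_(m, nB)) (OPT : {set 'I_nB})
  (eps delta : R) (r s : nat) (sel : {set 'I_nB} -> {set 'I_nB} -> 'I_nB) :
  (forall j, col j A != 0) -> (forall j, col j B != 0) ->
  #|OPT| = k ->
  (forall S : {set 'I_nB}, #|S| = k -> fA A B S <= fA A B OPT) ->
  0 < sigma_min B OPT ->
  0 < eps -> 0 < delta -> eps + delta <= 1 ->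
  s%:R = nB%:R * ln (delta^-1) / k%:R ->
  r%:R = 16 * k%:R / (eps * sigma_min B OPT) ->
  is_greedy_sel A B sel ->
  (1 - eps - delta) * fA A B OPT <= ltl_exp (fA A B) sel s r finset.set0 /\
  (ltl_evals sel s r finset.set0)%:R <= 16 * nB%:R * ln (delta^-1) / (eps * sigma_min B OPT).
Proof.
move=> _ colB_neq0 OPTk _ sigma_gt0 eps_gt0 delta_gt0 eps_delta sE rE sel_greedy.
have k_gt0 : (0 < k)%N by rewrite -OPTk (sigma_min_gt0_card sigma_gt0).
have kR_gt0 : 0 < k%:R :> R by rewrite ltr0n.
split; last first.
  apply: (@le_trans _ _ (r * s)%:R); first by rewrite ler_nat ltl_evals_le.
  rewrite natrM sE rE le_eqVlt; apply/orP; left; apply/eqP; field.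
  by rewrite !gt_eqF.
set F := fA A B OPT; set sigma := sigma_min B OPT in sigma_gt0 rE *.
have F_ge0 : 0 <= F by apply: frob2_ge0.
have delta_le1 : 0 <= 1 - delta by lra.
pose c := (1 - delta) * sigma / (4 * k%:R * F).
have c_ge0 : 0 <= c by rewrite divr_ge0 ?mulr_ge0 ?(ltW sigma_gt0).
have sum_gain_ge0 T : 0 <= (1 - delta) / k%:R * \sum_(w in OPT) gain A B T w.
  by rewrite mulr_ge0 ?divr_ge0 ?sumr_ge0 // => w _; apply: gain_ge0.
have step T : fA A B T + (1 - delta) / k%:R * \sum_(w in OPT) gain A B T w <=
    (\sum_(Q | validQ s T Q) fA A B (ltl_step sel T Q)) /
      #|[set Q : {set 'I_nB} | validQ s T Q]|%:R.
  by apply: expected_step_ge; rewrite ?OPTk.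
have step_ge T : fA A B T <=
    (\sum_(Q | validQ s T Q) fA A B (ltl_step sel T Q)) /
      #|[set Q : {set 'I_nB} | validQ s T Q]|%:R.
  by apply: le_trans (step T); rewrite lerDl.
have step_sq_ge T : fA A B T <= F -> fA A B T + c * (F - fA A B T) ^+ 2 <=
    (\sum_(Q | validQ s T Q) fA A B (ltl_step sel T Q)) /
      #|[set Q : {set 'I_nB} | validQ s T Q]|%:R.
  move=> le_TF; apply: le_trans (step T); rewrite lerD2l.
  (* If [F = 0], then [c = 0], as the inverse of 0 is 0. *)
  have [F0|Fn0] := eqVneq F 0; first by rewrite /c F0 mulr0 invr0 mulr0 mul0r.
  have F_gt0 : 0 < F by rewrite lt_def Fn0.
  have := sum_gain_ge colB_neq0 sigma_gt0 le_TF; rewrite -/F -/sigma => gain_le.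
  have -> : c * (F - fA A B T) ^+ 2 =
      (1 - delta) / k%:R * (sigma * (F - fA A B T) ^+ 2 / (4 * F)).
    by rewrite /c; field; rewrite Fn0 gt_eqF.
  rewrite ler_wpM2l ?divr_ge0 // ler_pdivrMr ?mulr_gt0 //.
  by rewrite [leRHS]mulrC.
(* The tangency point is the initial deficit [F], since [f] vanishes on the empty set; there the
   bound equals [F / (1 + c r F)]. *)
have := ltl_exp_ge c_ge0 step_ge step_sq_ge r finset.set0 F_ge0.
rewrite fA_set0 subr0.
have [->|Fn0] := eqVneq F 0.
  by rewrite expr0n /= !mulr0 addr0 mul0r sub0r oppr_le0.
have F_gt0 : 0 < F by rewrite lt_def Fn0.
have crF : c * r%:R * F = 4 * (1 - delta) / eps.
  by rewrite /c rE; field; rewrite Fn0 !gt_eqF.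
have den_gt0 : 0 < eps + 4 * (1 - delta) by lra.
have -> : (F + c * r%:R * F ^+ 2) / (1 + c * r%:R * F) ^+ 2 =
    F * (eps / (eps + 4 * (1 - delta))).
  rewrite [F ^+ 2]expr2 [c * r%:R * (F * F)]mulrA crF; field.
  by rewrite !gt_eqF //; lra.
(* Cross-multiplied, the difference is [eps^2 + 3 eps (1 - delta) + 4 delta (1 - delta)]. *)
have ratio_le : eps / (eps + 4 * (1 - delta)) <= eps + delta.
  rewrite ler_pdivrMr //.
  have := mulr_ge0 (ltW delta_gt0) (_ : 0 <= 1 - delta - eps).
  have := mulr_gt0 eps_gt0 delta_gt0; have := mulr_gt0 eps_gt0 eps_gt0.
  move=> e1 e2 /(_ ltac:(lra)); nra.
have := ler_wpM2l F_ge0 ratio_le; lra.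
Qed.
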